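(* Let $(A,B,C)\neq(6,7,10)$ be a nontrivial solution triple of $A!\,B!=C!$. Then: (i) For every real number $u>-\frac{1+\log\log 2}{\log 2}=-0.9139\dots$ there exists $B_0=B_0(u)$ such that every such nontrivial solution with $B\ge B_0$ satisfies $$C-B\le\frac{\log\log(B+1)}{\log2}+u.$$ (ii) Every such nontrivial solution satisfies $$C-B\le\frac{\log\log(B+1)}{\log2}+1.819.$$
   Context: A nontrivial solution triple of the equation $A!\,B!=C!$ is a triple of positive integers $(A,B,C)$ with $A\le B\le C-2$ satisfying $A!\,B!=C!$. Here $\log$ denotes the natural logarithm. *)

(* Defs.v *)
From Stdlib Require Import Arith Factorial.

(* [B <= C - 2] is written [B + 2 <= C], avoiding the truncated subtraction
   of [nat]. *)
Definition nontrivial_solution (A B C : nat) : Prop :=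
  0 < A /\ 0 < B /\ 0 < C /\ A <= B /\ B + 2 <= C /\
  fact A * fact B = fact C.

(* Main.v *)
Require Import Defs.
From Stdlib Require Import Reals Arith Factorial NArith Lia Lra Psatz.
From Coquelicot Require Import Coquelicot.

(* Put K = C - B and L = log (B+1), so that A! = (B+1)...(B+K). The 2-adic
   valuation v(n!) satisfies n - log2 (n+1) <= v(n!) < n; comparing it on both
   sides gives A + 1 <= K + log2 (A+1) + log2 (B+1), while the size of the product
   gives K L <= log A!. So A is close to L / log 2, and then
   K <= (A log A - A + ...) / L is close to (log L - log log 2 - 1) / log 2, which
   is the constant in (i).
   For (ii), suppose K is so large that (B+1)^16 < 2^(7 * 2^K). If K <= 7, then
   A < 70. If K >= 8, then A < 2^(K-1), hence log2 A! <= A (K-2), and eliminating B from the two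
   inequalities gives A <= K^2; repeating this with the improved bound on A ends
   at A <= 168. For each remaining pair (A, K), either the two inequalities are
   contradictory or A! lies strictly between two consecutive values of
   (x+1)...(x+K), with the exception of (6,7,10) and of 7! 6! = 10!, where A > B. *)

Local Open Scope nat_scope.

(** * The 2-adic valuation of factorials *)

Lemma pow2_pos (n : nat) : 0 < 2 ^ n.
Proof. apply Nat.neq_0_lt_0, Nat.pow_nonzero; discriminate. Qed.

(** Strong induction by halving: (2h)! = 2^h h! d with d a product of odd numbers, so v((2h)!) = h +
    v(h!), and the odd factor 2h + 1 does not change the valuation. *)
Lemma fact_two_part (n : nat) :
  exists v m, fact n = 2 ^ v * m /\ Nat.odd m = true /\ v <= pred n /\
    2 ^ n <= (n + 1) * 2 ^ v.
Proof.
assert (step : forall h, exists d, Nat.odd d = true /\ fact (2 * h) = 2 ^ h * fact h * d).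
{ induction h as [|h [d [d_odd IH]]].
  - exists 1; split; reflexivity.
  - exists (d * (2 * h + 1)); split.
    + rewrite Nat.odd_mul, d_odd, Nat.add_1_r, Nat.odd_succ, Nat.even_mul; reflexivity.
    + replace (2 * S h) with (S (S (2 * h))) by lia.
      rewrite !fact_simpl, IH, Nat.pow_succ_r'; ring. }
induction n as [n IH] using lt_wf_ind.
destruct (le_lt_dec n 0) as [n0|n_pos].
{ replace n with 0 by lia; exists 0, 1; repeat split; auto with arith. }
destruct (Nat.Even_or_Odd n) as [[h n_h]|[h n_h]]; subst n;
  destruct (IH h ltac:(lia)) as [v [m [hE [m_odd [v_le v_ge]]]]];
  destruct (step h) as [d [d_odd hd]];
  pose proof (pow2_pos h);
  pose proof (pow2_pos v);
  assert (pow2h : 2 ^ (2 * h) = 2 ^ h * 2 ^ h)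
    by (rewrite <- Nat.pow_add_r; f_equal; lia);
  assert (2 ^ h * 2 ^ h <= 2 ^ h * ((h + 1) * 2 ^ v)) by (apply Nat.mul_le_mono_l; exact v_ge).
- exists (h + v), (m * d); rewrite Nat.odd_mul, m_odd, d_odd, hd, hE, Nat.pow_add_r.
  repeat split; [ring | lia |].
  rewrite pow2h; nia.
- exists (h + v), (m * d * (2 * h + 1)).
  rewrite !Nat.odd_mul, m_odd, d_odd, Nat.pow_add_r.
  replace (2 * h + 1) with (S (2 * h)) by lia.
  rewrite Nat.odd_succ, Nat.even_mul, fact_simpl, hd, hE.
  repeat split; [ring | lia |].
  rewrite Nat.pow_succ_r', pow2h; nia.
Qed.

Lemma two_part_unique (a b m n : nat) :
  Nat.odd m = true -> Nat.odd n = true -> 2 ^ a * m = 2 ^ b * n -> a = b.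
Proof.
intros m_odd n_odd.
assert (even_pow : forall c x, Nat.even (2 ^ S c * x) = true).
{ intros c x; rewrite Nat.pow_succ_r', !Nat.even_mul; reflexivity. }
revert b; induction a as [|a IH]; intros [|b] E; auto.
- exfalso; pose proof (even_pow b n) as H; rewrite <- E in H.
  rewrite Nat.pow_0_r, Nat.mul_1_l, <- Nat.negb_odd, m_odd in H; discriminate.
- exfalso; pose proof (even_pow a m) as H; rewrite E in H.
  rewrite Nat.pow_0_r, Nat.mul_1_l, <- Nat.negb_odd, n_odd in H; discriminate.
- f_equal; apply IH; rewrite !Nat.pow_succ_r' in E; lia.
Qed.

Lemma solution_two_adic (A B K : nat) :
  0 < B -> fact A * fact B = fact (B + K) ->
  2 ^ (A + 1) <= (A + 1) * (B + 1) * 2 ^ K.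
Proof.
intros B_pos E.
destruct (fact_two_part A) as [a [p [EA [p_odd [_ geA]]]]].
destruct (fact_two_part B) as [b [q [EB [q_odd [_ geB]]]]].
destruct (fact_two_part (B + K)) as [c [r [EC [r_odd [leC _]]]]].
rewrite EA, EB, EC in E.
assert (abc : a + b = c).
{ apply (two_part_unique _ _ (p * q) r); auto.
  - rewrite Nat.odd_mul, p_odd, q_odd; reflexivity.
  - rewrite Nat.pow_add_r; lia. }
assert (le2 : 2 ^ A * 2 ^ B <= (A + 1) * 2 ^ a * ((B + 1) * 2 ^ b))
  by (apply Nat.mul_le_mono; assumption).
(* The strict bound v(C!) < C supplies the extra factor 2, hence the exponent A + 1 instead of A. *)
assert (le3 : 2 * 2 ^ (a + b) <= 2 ^ B * 2 ^ K).
{ rewrite <- Nat.pow_succ_r', <- Nat.pow_add_r; apply Nat.pow_le_mono_r; lia. }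
rewrite Nat.pow_add_r in le3.
pose proof (pow2_pos B).
rewrite Nat.add_1_r at 1; rewrite Nat.pow_succ_r'.
apply (Nat.mul_le_mono_pos_r _ _ (2 ^ B)); [assumption|].
apply (Nat.mul_le_mono_l _ _ ((A + 1) * (B + 1))) in le3.
lia.
Qed.

(** * Size estimates for factorials and powers *)

Lemma pow_mul_fact_le (B K : nat) : (B + 1) ^ K * fact B <= fact (B + K).
Proof.
induction K as [|K IH]; [rewrite Nat.add_0_r, Nat.pow_0_r; lia|].
rewrite (Nat.add_succ_r B K), fact_simpl, Nat.pow_succ_r', <- Nat.mul_assoc.
apply Nat.mul_le_mono; lia.
Qed.

Lemma solution_pow_le (A B K : nat) :
  fact A * fact B = fact (B + K) -> (B + 1) ^ K <= fact A.
Proof.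
intros E; pose proof (pow_mul_fact_le B K) as H; rewrite <- E in H.
exact (proj2 (Nat.mul_le_mono_pos_r _ _ _ (lt_O_fact B)) H).
Qed.

(** Induction from 6! 2^6 = 46080 <= 46656 = 6^6; the inequality fails at 5. The step needs (1 +
    1/n)^n >= 2, which is Bernoulli's inequality [bern]. *)
Lemma fact_mul_pow2_le (n : nat) : 6 <= n -> fact n * 2 ^ n <= n ^ n.
Proof.
assert (bern : forall x k, x ^ S k + S k * x ^ k <= S x ^ S k).
{ intros x k; induction k as [|k IH]; [simpl; lia|].
  rewrite (Nat.pow_succ_r' (S x) (S k)), (Nat.pow_succ_r' x (S k)).
  apply (Nat.mul_le_mono_l _ _ (S x)) in IH.
  rewrite (Nat.pow_succ_r' x k) in *; nia. }
induction n as [|n IH]; [lia|intros n_ge].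
destruct (Nat.eq_dec n 5) as [->|n5].
{ apply Nat.leb_le; vm_compute; reflexivity. }
assert (n6 : 6 <= n) by lia; specialize (IH n6).
assert (twice : 2 * n ^ n <= S n ^ n).
{ destruct n as [|k]; [lia|].
  pose proof (bern (S k) k); rewrite (Nat.pow_succ_r' (S k)) in *; lia. }
rewrite fact_simpl, !Nat.pow_succ_r'; nia.
Qed.

Lemma fact_lt_pow (n : nat) : fact n < (n + 1) ^ n \/ n = 0.
Proof.
induction n as [|n IH]; [auto|left].
assert (S n ^ n <= (S n + 1) ^ n) by (apply Nat.pow_le_mono_l; lia).
assert (0 < S n ^ n) by (apply Nat.neq_0_lt_0, Nat.pow_nonzero; lia).
rewrite fact_simpl, Nat.pow_succ_r'; destruct IH as [IH| ->]; [|simpl; lia].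
rewrite Nat.add_1_r in IH; nia.
Qed.

(** Monotonicity of 2^x / x, cleared of denominators; it lets [first_factor_lt] replace A + 1 by a
    smaller x. *)
Lemma pow2_mul_le (x y : nat) : 1 <= x <= y -> 2 ^ x * y <= 2 ^ y * x.
Proof.
intros [x_pos xy]; induction xy as [|y xy IH]; [lia|].
rewrite Nat.pow_succ_r'; nia.
Qed.

(** * The finite table of pairs (A, K) with A <= 168, in binary arithmetic *)

Fixpoint rising (x : N) (k : nat) : N :=
  match k with
  | O => 1%N
  | S k' => ((x + 1) * rising (x + 1) k')%N
  end.

Lemma rising_fact (B K : nat) :
  N.of_nat (fact (B + K)) = (N.of_nat (fact B) * rising (N.of_nat B) K)%N.
Proof.
revert B; induction K as [|K IH]; intros B; simpl rising.
- rewrite Nat.add_0_r, N.mul_1_r; reflexivity.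
- rewrite Nat.add_succ_r, <- Nat.add_succ_l, IH, fact_simpl.
  replace (N.of_nat B + 1)%N with (N.of_nat (S B)) by lia.
  rewrite Nat2N.inj_mul; ring.
Qed.

Lemma rising_mono (x y : N) (k : nat) : (x <= y)%N -> (rising x k <= rising y k)%N.
Proof.
revert x y; induction k as [|k IH]; intros x y xy; simpl; [lia|].
apply N.mul_le_mono; [lia|apply IH; lia].
Qed.

(** Greedy choice of binary digits from the top. A root x of [rising x k <= f] satisfies x^k <= f,
    so log2 f / k + 1 digits suffice. *)
Fixpoint root_search (k : nat) (f m : N) (bits : nat) : N :=
  match bits with
  | O => m
  | S b =>
      let m' := (m + N.shiftl 1 (N.of_nat b))%N in
      root_search k f (if (rising m' k <=? f)%N then m' else m) b
  end.

(* The guess [m] for the largest integer with [rising m K <= f] is unverified;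
   the three comparisons certify the exclusion. *)
Definition no_base (a f : N) (K : nat) : bool :=
  let m := root_search K f 0 (N.to_nat (N.log2 f / N.of_nat K + 1)) in
  if (f <? rising (m + 1) K)%N then
    if (rising m K <? f)%N then true else (m <? a)%N
  else false.

(* Here [p] and [l] are the integer parts of the base-2 logarithms of [(a+1)^4]
   (the fourth power gains precision) and of [f = a!]. The first three tests
   detect that one of the first three hypotheses of [pair_excluded_sound] fails. *)
Definition pair_excluded (a f p l : N) (K : nat) : bool :=
  let k := N.of_nat K in
  if (4 * (l + 1) <=? k * p)%N then true else
  if (4 * k * k + k * (p + 1) + 4 * (l + 1) <=? 4 * (a + 1) * k)%N then true else
  if (16 * k + 4 * (p + 1) + N.shiftl 7 k <=? 16 * (a + 1))%N then true else
  if (a =? 6)%N then if (k =? 3)%N then true else no_base a f K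
  else no_base a f K.

(** K = 0 and K = 1 are outside the problem; K > a is excluded by size in [solution_gap_pow2]. *)
Fixpoint row_excluded (a f p l : N) (K : nat) : bool :=
  match K with
  | O | 1 => true
  | S K' => if pair_excluded a f p l K then row_excluded a f p l K' else false
  end.

(** Called with f = a!, an invariant kept by updating f along with a. *)
Fixpoint table_excluded (n : nat) (a f : N) : bool :=
  match n with
  | O => true
  | S n' =>
      if row_excluded a f (N.log2 ((a + 1) ^ 4)) (N.log2 f) (N.to_nat a)
      then table_excluded n' (a + 1) ((a + 1) * f)
      else false
  end.

Lemma table_excluded_168 : table_excluded 169 0 1 = true.
Proof. vm_compute; reflexivity. Qed.

(** Since f < [rising (m + 1) K], a solution b has b <= m by monotonicity; then either
    [rising b K <= rising m K < f], or m < a <= b. *)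
Lemma no_base_sound (a f b : N) (K : nat) :
  no_base a f K = true -> (a <= b)%N -> rising b K <> f.
Proof.
unfold no_base; set (m := root_search _ _ _ _); clearbody m; cbv zeta.
intros H ab E.
destruct (N.ltb_spec f (rising (m + 1) K)) as [up|]; [|discriminate].
assert (bm : (b <= m)%N).
{ apply N.nlt_ge; intros mb.
  assert (rising (m + 1) K <= rising b K)%N by (apply rising_mono; lia); lia. }
pose proof (rising_mono b m K bm).
destruct (N.ltb_spec (rising m K) f); [lia|].
apply N.ltb_lt in H; lia.
Qed.

Lemma row_excluded_sound (a f p l : N) (n K : nat) :
  row_excluded a f p l n = true -> 2 <= K <= n -> pair_excluded a f p l K = true.
Proof.
induction n as [|n IH]; intros H K_bd; [lia|].
destruct n as [|n]; [lia|].
change (row_excluded a f p l (S (S n))) with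
  (if pair_excluded a f p l (S (S n)) then row_excluded a f p l (S n) else false) in H.
destruct (pair_excluded a f p l (S (S n))) eqn:E; [|discriminate].
destruct (Nat.eq_dec K (S (S n))) as [->|]; [exact E|apply IH; [exact H|lia]].
Qed.

Lemma table_excluded_sound (n i A : nat) :
  table_excluded n (N.of_nat i) (N.of_nat (fact i)) = true -> i <= A < i + n ->
  row_excluded (N.of_nat A) (N.of_nat (fact A))
    (N.log2 ((N.of_nat A + 1) ^ 4)) (N.log2 (N.of_nat (fact A))) A = true.
Proof.
revert i; induction n as [|n IH]; intros i H A_bd; [lia|].
simpl table_excluded in H; rewrite Nat2N.id in H.
destruct (row_excluded _ _ _ _ _) eqn:E in H; [|discriminate].
destruct (Nat.eq_dec A i) as [->|]; [exact E|].
apply (IH (S i)); [|lia].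
rewrite fact_simpl, Nat2N.inj_mul, Nat2N.inj_succ, <- N.add_1_r; exact H.
Qed.

Lemma pow2_inj_le (x y : nat) : 2 ^ x <= 2 ^ y -> x <= y.
Proof. apply Nat.pow_le_mono_r_iff; lia. Qed.

(** * Inequalities between integer parts of base-2 logarithms *)

Section N_logs.
Local Open Scope N_scope.

(** Here and in the next two lemmas c is A + 1, with log2 c between p/4 and (p + 1)/4 and log2 f
    below l + 1. Taking logarithms in the first hypothesis and multiplying by 4 to clear these
    quarters gives the conclusion, the negation of a test of [pair_excluded]. *)
Lemma log_bound_fact (c f p l k : N) :
  c ^ k <= f -> 2 ^ p <= c ^ 4 -> f < 2 ^ (l + 1) -> k * p < 4 * (l + 1).
Proof.
intros cf pc fl; apply N.nle_gt; intros H.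
apply (N.pow_le_mono_r 2) in H; [|discriminate].
rewrite (N.mul_comm k p), (N.mul_comm 4), !N.pow_mul_r in H.
apply (N.pow_le_mono_l _ _ k) in pc.
rewrite <- (N.pow_mul_r c), (N.mul_comm 4 k), (N.pow_mul_r c) in pc.
apply (N.pow_le_mono_l _ _ 4) in cf.
apply (N.pow_lt_mono_l _ _ 4) in fl; [|discriminate].
lia.
Qed.

Lemma log_bound_dyadic (c f p l k : N) :
  2 ^ (c * k) <= c ^ k * 2 ^ (k * k) * f -> c ^ 4 < 2 ^ (p + 1) -> f < 2 ^ (l + 1) ->
  4 * c * k < 4 * k * k + k * (p + 1) + 4 * (l + 1).
Proof.
intros H cp fl; apply N.nle_gt; intros le.
apply (N.pow_le_mono_r 2) in le; [|discriminate].
apply (N.pow_le_mono_l _ _ 4) in H.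
rewrite !N.pow_mul_l, <- !N.pow_mul_r in H.
apply N.lt_le_incl, (N.pow_le_mono_l _ _ k) in cp.
rewrite <- !N.pow_mul_r in cp.
apply (N.pow_lt_mono_l _ _ 4) in fl; [|discriminate].
rewrite <- N.pow_mul_r in fl.
rewrite !N.pow_add_r in le.
replace (4 * k * k) with (k * k * 4) in le by lia.
replace (k * (p + 1)) with ((p + 1) * k) in le by lia.
replace (4 * (l + 1)) with ((l + 1) * 4) in le by lia.
replace (4 * c * k) with (c * k * 4) in le by lia.
replace (4 * k) with (k * 4) in cp by lia.
assert (lt : c ^ (k * 4) * 2 ^ (k * k * 4) * f ^ 4
             < 2 ^ (k * k * 4) * 2 ^ ((p + 1) * k) * 2 ^ ((l + 1) * 4)).
{ apply N.le_lt_trans with (2 ^ (k * k * 4) * 2 ^ ((p + 1) * k) * f ^ 4).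
  - apply N.mul_le_mono_r; rewrite N.mul_comm; apply N.mul_le_mono_l; exact cp.
  - apply N.mul_lt_mono_pos_l; [|exact fl].
    apply N.mul_pos_pos; apply N.neq_0_lt_0, N.pow_nonzero; discriminate. }
exact (N.lt_irrefl _ (N.le_lt_trans _ _ _ (N.le_trans _ _ _ le H) lt)).
Qed.

Lemma log_bound_small (c p x y : N) :
  2 ^ (16 * x) < c ^ 16 * 2 ^ y -> c ^ 4 < 2 ^ (p + 1) ->
  16 * x < y + 4 * (p + 1).
Proof.
intros H cp; apply (N.pow_lt_mono_r_iff 2); [reflexivity|].
rewrite N.pow_add_r.
apply N.lt_le_incl, (N.pow_le_mono_l _ _ 4) in cp.
rewrite <- !N.pow_mul_r, (N.mul_comm (p + 1)) in cp.
change (4 * 4) with 16 in cp.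
apply (N.lt_le_trans _ _ _ H); rewrite N.mul_comm; apply N.mul_le_mono_l; exact cp.
Qed.

End N_logs.

(** The hypotheses make the first three tests fail, so the answer [true] comes from [no_base] or
    from the exempted pair (6, 3), where 6! = 8 * 9 * 10 is a genuine solution. *)
Lemma pair_excluded_sound (a f p l : N) (K : nat) (k := N.of_nat K) :
  ((a + 1) ^ k <= f)%N ->
  (2 ^ ((a + 1) * k) <= (a + 1) ^ k * 2 ^ (k * k) * f)%N ->
  (2 ^ (16 * (a + 1)) < (a + 1) ^ 16 * 2 ^ (16 * k + 7 * 2 ^ k))%N ->
  (2 ^ p <= (a + 1) ^ 4 < 2 ^ (p + 1))%N -> (f < 2 ^ (l + 1))%N ->
  pair_excluded a f p l K = true ->
  no_base a f K = true \/ (a = 6%N /\ K = 3).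
Proof.
intros hfact hdyad hsmall [p_le p_gt] l_gt.
pose proof (log_bound_fact _ _ _ _ _ hfact p_le l_gt) as c1.
pose proof (log_bound_dyadic _ _ _ _ _ hdyad p_gt l_gt) as c2.
pose proof (log_bound_small _ _ _ _ hsmall p_gt) as c3.
clear hfact hdyad hsmall p_le p_gt l_gt.
unfold pair_excluded; fold k; rewrite N.shiftl_mul_pow2.
destruct (N.leb_spec (4 * (l + 1)) (k * p)); [lia|].
destruct (N.leb_spec (4 * k * k + k * (p + 1) + 4 * (l + 1)) (4 * (a + 1) * k)); [lia|].
destruct (N.leb_spec (16 * k + 4 * (p + 1) + 7 * 2 ^ k) (16 * (a + 1))); [lia|].
destruct (N.eqb_spec a 6); [destruct (N.eqb_spec k 3)|]; auto.
intros _; right; split; [assumption|lia].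
Qed.

(** The last three hypotheses are free of B, so they can be tested on the pair (A, K) alone; B
    enters through A! = (B+1)...(B+K), refuted by [no_base] using A <= B. *)
Lemma no_solution_168 (A B K : nat) :
  A <= B -> 2 <= K <= A -> A <= 168 -> A <> 6 \/ K <> 3 ->
  fact A * fact B = fact (B + K) ->
  2 ^ ((A + 1) * K) <= (A + 1) ^ K * 2 ^ (K * K) * fact A ->
  (A + 1) ^ K <= fact A ->
  2 ^ (16 * (A + 1)) < (A + 1) ^ 16 * 2 ^ (16 * K + 7 * 2 ^ K) ->
  False.
Proof.
intros AB K_bd A_bd ne E hdyad hfact hsmall.
pose proof (table_excluded_sound 169 0 A table_excluded_168 ltac:(lia)) as row.
pose proof (row_excluded_sound _ _ _ _ _ _ row K_bd) as pair; clear row.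
assert (Ea : N.of_nat (A + 1) = (N.of_nat A + 1)%N) by lia.
apply pair_excluded_sound in pair.
- destruct pair as [nb|[a6 K3]]; [|lia].
  apply (no_base_sound _ _ (N.of_nat B) _ nb); [lia|].
  pose proof (rising_fact B K) as R; rewrite <- E, Nat2N.inj_mul in R.
  pose proof (lt_O_fact B); nia.
- rewrite <- Ea, <- Nat2N.inj_pow; lia.
- rewrite <- Ea; change 2%N with (N.of_nat 2).
  rewrite <- !Nat2N.inj_mul, <- !Nat2N.inj_pow, <- !Nat2N.inj_mul; lia.
- rewrite <- Ea; change 2%N with (N.of_nat 2).
  change 16%N with (N.of_nat 16); change 7%N with (N.of_nat 7).
  rewrite <- (Nat2N.inj_pow 2 K), <- !Nat2N.inj_mul, <- Nat2N.inj_add,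
    <- !Nat2N.inj_pow, <- Nat2N.inj_mul.
  generalize dependent (2 ^ (16 * (A + 1))); intros; lia.
- rewrite (N.add_1_r (N.log2 _)); apply N.log2_spec, N.neq_0_lt_0, N.pow_nonzero; lia.
- rewrite (N.add_1_r (N.log2 _)); apply N.log2_spec; pose proof (lt_O_fact A); lia.
Qed.

(** * Reduction to A <= 168 and the integer form of the gap bound *)

Lemma lt_pow2_bound (A K n : nat) :
  6 <= A -> A + 1 <= 2 ^ n ->
  2 ^ ((A + 1) * K) <= (A + 1) ^ K * 2 ^ (K * K) * fact A ->
  (A + 1) * K + A <= n * K + K * K + n * A.
Proof.
intros A6 An H; apply pow2_inj_le; rewrite !Nat.pow_add_r.
rewrite (Nat.pow_mul_r 2 n K), (Nat.pow_mul_r 2 n A).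
(* After multiplication by 2^A, A! 2^A <= A^A <= 2^(n A) amounts to log2 A! <= (n - 1) A. *)
apply Nat.le_trans with ((A + 1) ^ K * 2 ^ (K * K) * (fact A * 2 ^ A)).
{ rewrite Nat.mul_assoc; apply Nat.mul_le_mono_r; exact H. }
repeat apply Nat.mul_le_mono; auto using Nat.pow_le_mono_l.
apply Nat.le_trans with (A ^ A); [apply fact_mul_pow2_le; lia|].
apply Nat.pow_le_mono_l; lia.
Qed.

(** A^K 2^A <= A! 2^A <= A^A gives 2^A <= A^(A-K): K cannot be too close to A. *)
Lemma pow_fact_bound (A K n : nat) :
  6 <= A -> K <= A -> A + 1 <= 2 ^ n -> (A + 1) ^ K <= fact A -> A <= n * (A - K).
Proof.
intros A6 KA An H; apply pow2_inj_le; rewrite Nat.pow_mul_r.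
apply Nat.le_trans with (A ^ (A - K)); [|apply Nat.pow_le_mono_l; lia].
assert (pos : 0 < A ^ K) by (apply Nat.neq_0_lt_0, Nat.pow_nonzero; lia).
apply (Nat.mul_le_mono_pos_l _ _ _ pos).
rewrite <- Nat.pow_add_r; replace (K + (A - K)) with A by lia.
apply Nat.le_trans with (fact A * 2 ^ A); [|apply fact_mul_pow2_le; lia].
apply Nat.mul_le_mono_r; apply Nat.le_trans with ((A + 1) ^ K); [|exact H].
apply Nat.pow_le_mono_l; lia.
Qed.

Lemma pow2_gt_quadratic (n : nat) : 9 <= n -> 3 * n * n < 2 ^ (n - 1) + 3 * n.
Proof.
intros n9; replace n with (9 + (n - 9)) by lia; generalize (n - 9); clear n n9.
induction n as [|n IH]; [apply Nat.ltb_lt; vm_compute; reflexivity|].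
replace (9 + S n - 1) with (S (9 + n - 1)) by lia; rewrite Nat.pow_succ_r'; nia.
Qed.

(** For 33 <= K < 64 this reads 36 <= K + 3, whence the threshold 33; beyond that, K >= 2^m and 6 (m
    + 1) <= 2^m for m >= 6. *)
Lemma log2_six_le (K : nat) : 33 <= K -> 6 * (Nat.log2 K + 1) <= K + 3.
Proof.
intros K33.
assert (log_ge : 5 <= Nat.log2 K) by (apply (Nat.log2_le_mono 32 K); lia).
destruct (Nat.eq_dec (Nat.log2 K) 5) as [->|]; [lia|].
destruct (Nat.log2_spec K ltac:(lia)) as [le _].
assert (grow : forall m, 6 * (6 + m + 1) <= 2 ^ (6 + m)).
{ induction m as [|m IH]; [simpl; lia|].
  rewrite (Nat.add_succ_r 6 m), Nat.pow_succ_r'; lia. }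
specialize (grow (Nat.log2 K - 6)).
replace (6 + (Nat.log2 K - 6)) with (Nat.log2 K) in grow by lia; lia.
Qed.

Lemma first_factor_le_168 (A K : nat) :
  8 <= K <= A -> A + 1 <= 2 ^ (K - 1) ->
  2 ^ ((A + 1) * K) <= (A + 1) ^ K * 2 ^ (K * K) * fact A ->
  (A + 1) ^ K <= fact A ->
  A <= 168.
Proof.
intros [K8 KA] A_small hdyad hfact.
pose proof (fun n h => lt_pow2_bound A K n ltac:(lia) h hdyad) as bound.
assert (A_le : A + K <= K * K).
{ destruct K as [|j]; [lia|]; specialize (bound _ A_small).
  simpl in bound; rewrite Nat.sub_0_r in bound; nia. }
destruct (le_lt_dec K 32) as [K32|K33].
(* For K <= 13, A <= K^2 - K <= 156. For 14 <= K <= 32, A + 1 <= 2^10 and n = 10 in [bound] gives A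
   (K - 9) <= K^2 + 9 K. *)
- destruct (le_lt_dec K 13); [nia|].
  assert (A + 1 <= 2 ^ 10) by (change (2 ^ 10) with (32 * 32); nia).
  specialize (bound _ H); nia.
(* With n = 2 k and 6 k <= K + 3, [bound] becomes (2 K / 3) A <= 4 K^2 / 3. *)
- assert (A2K : A <= 2 * K).
  { set (k := Nat.log2 K + 1).
    assert (A + 1 <= 2 ^ (2 * k)).
    { pose proof (proj2 (Nat.log2_spec K ltac:(lia))) as lt.
      rewrite <- (Nat.add_1_r (Nat.log2 K)) in lt; fold k in lt.
      replace (2 * k) with (k + k) by lia; rewrite Nat.pow_add_r.
      assert (K * K <= 2 ^ k * 2 ^ k) by (apply Nat.mul_le_mono; lia); lia. }
    pose proof (log2_six_le K K33); fold k in H0.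
    specialize (bound _ H); nia. }
  set (n := Nat.log2 A + 1).
  destruct (Nat.log2_spec A ltac:(lia)) as [log_le log_lt].
  rewrite <- (Nat.add_1_r (Nat.log2 A)) in log_lt; fold n in log_lt.
  replace (Nat.log2 A) with (n - 1) in log_le by lia.
  assert (A_lt : A + 1 <= 2 ^ n) by lia.
  specialize (bound _ A_lt).
  pose proof (pow_fact_bound A K n ltac:(lia) KA A_lt hfact) as gap.
  assert (n_pos : 1 <= n) by lia.
  (* [bound] says K (A - K) <= (n - 1) (A + K), and A + K <= 3 K. With [gap], A <= n (3 n - 3). *)
  assert (A - K <= 3 * n - 3) by nia.
  destruct (le_lt_dec 9 n) as [n9|n8].
  (* For n >= 9 this contradicts A >= 2^(n-1); for n <= 8 it gives 8 * 21 = 168. *)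
  + pose proof (pow2_gt_quadratic n n9); nia.
  + assert (n * (A - K) <= 8 * 21) by (apply Nat.mul_le_mono; lia); lia.
Qed.

(** Since 2^x / x is nondecreasing, 2^x <= x (B+1) 2^K; the sixteenth power and the smallness of B
    remove B. Used contrapositively: an x <= 2^j violating the conclusion exceeds A + 1. *)
Lemma first_factor_lt (A B K x j : nat) :
  2 ^ (A + 1) <= (A + 1) * (B + 1) * 2 ^ K ->
  (B + 1) ^ 16 < 2 ^ (7 * 2 ^ K) ->
  1 <= x <= A + 1 -> x <= 2 ^ j ->
  16 * x < 7 * 2 ^ K + 16 * (K + j).
Proof.
intros dyad small x_bd xj.
pose proof (pow2_mul_le x (A + 1) x_bd) as cmp.
assert (le : 2 ^ x <= (B + 1) * 2 ^ (K + j)).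
{ assert (pos : 0 < A + 1) by lia; apply (Nat.mul_le_mono_pos_r _ _ _ pos).
  apply Nat.le_trans with (1 := cmp).
  apply Nat.le_trans with ((A + 1) * (B + 1) * 2 ^ K * 2 ^ j).
  - apply Nat.mul_le_mono; assumption.
  - rewrite Nat.pow_add_r; lia. }
apply (Nat.pow_le_mono_l _ _ 16) in le.
rewrite Nat.pow_mul_l, <- !Nat.pow_mul_r in le.
apply (Nat.pow_lt_mono_r_iff 2); [lia|].
rewrite Nat.pow_add_r, (Nat.mul_comm 16 x), (Nat.mul_comm 16 (K + j)).
apply (Nat.le_lt_trans _ _ _ le), Nat.mul_lt_mono_pos_r; [apply pow2_pos|exact small].
Qed.

(** In logarithms, K <= log2 log2 (B+1) + log2 (16/7); the exponents 7 and 16 keep this an integer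
    statement. *)
Lemma solution_gap_pow2 (A B K : nat) :
  0 < B -> 2 <= K -> A <= B -> A <> 6 \/ K <> 3 ->
  fact A * fact B = fact (B + K) ->
  2 ^ (7 * 2 ^ K) <= (B + 1) ^ 16.
Proof.
intros B_pos K2 AB ne E; apply Nat.nlt_ge; intros small.
pose proof (solution_two_adic A B K B_pos E) as dyad.
pose proof (solution_pow_le A B K E) as fact_ge.
assert (hfact : (A + 1) ^ K <= fact A).
{ apply Nat.le_trans with ((B + 1) ^ K); [apply Nat.pow_le_mono_l; lia|exact fact_ge]. }
(* The K-th power of [dyad], with B eliminated by (B+1)^K <= A!; [hsmall] eliminates B from the
   sixteenth power by [small]. *)
assert (hdyad : 2 ^ ((A + 1) * K) <= (A + 1) ^ K * 2 ^ (K * K) * fact A).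
{ apply (Nat.pow_le_mono_l _ _ K) in dyad.
  rewrite <- Nat.pow_mul_r, !Nat.pow_mul_l, <- (Nat.pow_mul_r 2 K K) in dyad.
  apply Nat.le_trans with (1 := dyad).
  rewrite <- Nat.mul_assoc, (Nat.mul_comm ((B + 1) ^ K)), Nat.mul_assoc.
  apply Nat.mul_le_mono_l; exact fact_ge. }
assert (hsmall : 2 ^ (16 * (A + 1)) < (A + 1) ^ 16 * 2 ^ (16 * K + 7 * 2 ^ K)).
{ apply (Nat.pow_le_mono_l _ _ 16) in dyad.
  rewrite <- Nat.pow_mul_r, !Nat.pow_mul_l, <- (Nat.pow_mul_r 2 K 16) in dyad.
  rewrite (Nat.mul_comm 16), (Nat.mul_comm 16 K).
  apply (Nat.le_lt_trans _ _ _ dyad); rewrite Nat.pow_add_r.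
  rewrite <- Nat.mul_assoc; apply Nat.mul_lt_mono_pos_l.
  - apply Nat.neq_0_lt_0, Nat.pow_nonzero; lia.
  - rewrite Nat.mul_comm; apply Nat.mul_lt_mono_pos_l; [apply pow2_pos|exact small]. }
assert (KA : K <= A).
{ apply Nat.nlt_ge; intros AK.
  destruct (fact_lt_pow A) as [lt| ->].
  - assert ((A + 1) ^ A <= (A + 1) ^ K) by (apply Nat.pow_le_mono_r; lia); lia.
  - pose proof (Nat.pow_gt_lin_r (B + 1) K ltac:(lia)); simpl in fact_ge; lia. }
apply (no_solution_168 A B K); auto.
destruct (le_lt_dec 8 K) as [K8|K7].
- apply (first_factor_le_168 A K); auto.
  apply Nat.nlt_ge; intros lt.
  (* If A + 1 > 2^(K-1), then x = 2^(K-1) yields 2^(K-1) < 16 K - 8, false for K >= 8. *)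
  pose proof (first_factor_lt A B K (2 ^ (K - 1)) (K - 1) dyad small
    (conj (pow2_pos _) (Nat.lt_le_incl _ _ lt)) (le_n _)) as bd.
  replace (2 ^ K) with (2 * 2 ^ (K - 1)) in bd
    by (rewrite <- Nat.pow_succ_r'; f_equal; lia).
  assert (grow : forall m, 16 * (8 + m) <= 2 ^ (8 + m - 1) + 8).
  { induction m as [|m IH]; [simpl; lia|].
    replace (8 + S m - 1) with (S (8 + m - 1)) by lia; rewrite Nat.pow_succ_r'; lia. }
  specialize (grow (K - 8)); replace (8 + (K - 8)) with K in grow by lia; lia.
- apply Nat.nlt_ge; intros A168.
  (* At K = 7, x = 70 and j = 7 give 1120 < 896 + 224 = 1120, which is false; smaller K only lowers
     the right side. *)
  assert (le : 70 <= 2 ^ 7) by (simpl; lia).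
  pose proof (first_factor_lt A B K 70 7 dyad small ltac:(lia) le) as bd.
  assert (2 ^ K <= 2 ^ 7) by (apply Nat.pow_le_mono_r; lia).
  change (2 ^ 7) with 128 in *; lia.
Qed.

(** * Real logarithms: Stirling-type and numerical bounds *)

Open Scope R_scope.

Lemma ln_le_sub1 (x : R) : 0 < x -> ln x <= x - 1.
Proof.
intros x_pos; pose proof (exp_ineq1_le (ln x)) as H.
rewrite exp_ln in H by assumption; lra.
Qed.

Lemma ln_le_tangent (x a : R) : 0 < x -> 0 < a -> ln x <= ln a + (x / a - 1).
Proof.
intros x_pos a_pos.
replace x with (a * (x / a)) at 1 by (field; lra).
assert (0 < x / a) by (apply Rdiv_lt_0_compat; assumption).
rewrite ln_mult by assumption.
pose proof (ln_le_sub1 (x / a)); lra.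
Qed.

(** The bound n! <= e n (n/e)^n. The induction step is the tangent inequality (n+1) ln n <= (n+1) ln
    (n+1) - 1. *)
Lemma ln_fact_le (n : nat) :
  (1 <= n)%nat -> ln (INR (fact n)) <= (INR n + 1) * ln (INR n) - INR n + 1.
Proof.
intros n_pos; induction n_pos as [|n n_pos IH].
{ simpl; rewrite ln_1; lra. }
rewrite fact_simpl, mult_INR, S_INR.
assert (n1 : 1 <= INR n) by (apply (le_INR 1); assumption).
rewrite ln_mult; [|lra|apply (lt_INR 0), lt_O_fact].
pose proof (ln_le_tangent (INR n) (INR n + 1) ltac:(lra) ltac:(lra)) as H.
apply (Rmult_le_compat_l (INR n + 1)) in H; [|lra].
replace ((INR n + 1) * (ln (INR n + 1) + (INR n / (INR n + 1) - 1)))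
  with ((INR n + 1) * ln (INR n + 1) - 1) in H by (field; lra).
lra.
Qed.

(** Taylor polynomial of degree 9 of 2 artanh x = ln ((1+x)/(1-x)). *)
Definition artanh_sum (x : R) : R :=
  2 * (x + x ^ 3 / 3 + x ^ 5 / 5 + x ^ 7 / 7 + x ^ 9 / 9).

(* Both differences have derivatives of constant sign on [0, 1):
   [2 x^10 / (1 - x^2)] for the first. *)
Lemma ln_artanh_bounds (x : R) :
  0 < x < 1 ->
  artanh_sum x <= ln ((1 + x) / (1 - x)) <= artanh_sum x + 2 * x ^ 11 / (11 * (1 - x ^ 2)).
Proof.
intros x_bd; unfold artanh_sum.
rewrite ln_div by lra; split.
- set (F t := ln (1 + t) - ln (1 - t)
    - 2 * (t + t ^ 3 / 3 + t ^ 5 / 5 + t ^ 7 / 7 + t ^ 9 / 9)).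
  destruct (MVT_gen F 0 x (fun t => 2 * t ^ 10 / (1 - t ^ 2))) as [c [c_bd E]].
  + intros t; rewrite Rmin_left, Rmax_right by lra; intros t_bd.
    unfold F; auto_derive; [lra|field; nra].
  + intros t; rewrite Rmin_left, Rmax_right by lra; intros t_bd.
    apply continuity_pt_filterlim, (ex_derive_continuous F); unfold F; auto_derive; lra.
  + rewrite Rmin_left, Rmax_right in c_bd by lra.
    assert (0 <= 2 * c ^ 10 / (1 - c ^ 2)).
    { apply Rdiv_le_0_compat; [apply Rmult_le_pos; [lra|apply pow_le; lra]|nra]. }
    assert (F0 : F 0 = 0) by (unfold F; rewrite Rplus_0_r, Rminus_0_r, ln_1; field).
    rewrite F0 in E; unfold F in E; nra.
- set (F t := 2 * (t + t ^ 3 / 3 + t ^ 5 / 5 + t ^ 7 / 7 + t ^ 9 / 9)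
    + 2 * t ^ 11 / (11 * (1 - t ^ 2)) - (ln (1 + t) - ln (1 - t))).
  destruct (MVT_gen F 0 x (fun t => 4 * t ^ 12 / (11 * (1 - t ^ 2) ^ 2))) as [c [c_bd E]].
  + intros t; rewrite Rmin_left, Rmax_right by lra; intros t_bd.
    unfold F; auto_derive; [nra|field; nra].
  + intros t; rewrite Rmin_left, Rmax_right by lra; intros t_bd.
    apply continuity_pt_filterlim, (ex_derive_continuous F); unfold F; auto_derive; nra.
  + rewrite Rmin_left, Rmax_right in c_bd by lra.
    assert (0 <= 4 * c ^ 12 / (11 * (1 - c ^ 2) ^ 2)).
    { apply Rdiv_le_0_compat; [apply Rmult_le_pos; [lra|apply pow_le; lra]|].
      apply Rmult_lt_0_compat; [lra|apply pow_lt; nra]. }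
    assert (F0 : F 0 = 0) by (unfold F; rewrite Rplus_0_r, Rminus_0_r, ln_1; field).
    rewrite F0 in E; unfold F in E; nra.
Qed.

Lemma ln2_bounds : 0.693146 < ln 2 < 0.693148.
Proof.
pose proof (ln_artanh_bounds (1 / 3) ltac:(lra)) as H.
replace ((1 + 1 / 3) / (1 - 1 / 3)) with 2 in H by field.
unfold artanh_sum in H; lra.
Qed.

(** This x has (1+x)/(1-x) = 1/y, which handles arguments below 1 such as ln 2. *)
Lemma ln_inv_artanh_bounds (y : R) (x := (1 - y) / (1 + y)) :
  0 < y < 1 ->
  - (artanh_sum x + 2 * x ^ 11 / (11 * (1 - x ^ 2))) <= ln y <= - artanh_sum x.
Proof.
intros y_bd.
assert (x_bd : 0 < x < 1).
{ unfold x; split; [apply Rdiv_lt_0_compat; lra|].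
  apply Rlt_div_l; lra. }
pose proof (ln_artanh_bounds x x_bd) as H.
replace ((1 + x) / (1 - x)) with (/ y) in H by (unfold x; field; lra).
rewrite ln_Rinv in H by lra; lra.
Qed.

Lemma lnln2_bounds : -0.36652 < ln (ln 2) < -0.36650.
Proof.
pose proof ln2_bounds as b.
pose proof (ln_inv_artanh_bounds 0.693146 ltac:(lra)) as lo.
pose proof (ln_inv_artanh_bounds 0.693148 ltac:(lra)) as hi.
pose proof (ln_increasing 0.693146 (ln 2) ltac:(lra) ltac:(lra)).
pose proof (ln_increasing (ln 2) 0.693148 ltac:(lra) ltac:(lra)).
unfold artanh_sum in lo, hi; lra.
Qed.

Lemma threshold_bounds : -0.9140 < - ((1 + ln (ln 2)) / ln 2) <= -0.9139.
Proof.
pose proof ln2_bounds; pose proof lnln2_bounds.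
assert (0.9139 <= (1 + ln (ln 2)) / ln 2) by (apply (proj1 (Rle_div_r _ _ (ln 2) ltac:(lra))); lra).
assert ((1 + ln (ln 2)) / ln 2 < 0.9140) by (apply (proj2 (Rlt_div_l _ _ (ln 2) ltac:(lra))); lra).
lra.
Qed.

(** * Logarithmic inequalities for solutions and the asymptotic gap *)

Lemma solution_dyadic_ln (A B K : nat) (L := ln (INR B + 1)) :
  (0 < B)%nat -> (fact A * fact B = fact (B + K))%nat -> (INR A + 1) * ln 2 <= ln (INR A + 1) + L + INR K * ln 2.
Proof.
intros B_pos E; pose proof (solution_two_adic A B K B_pos E) as H; apply le_INR in H.
pose proof (pos_INR A); pose proof (pos_INR B).
rewrite !mult_INR, !pow_INR, !plus_INR in H; simpl (INR 1) in H; simpl (INR 2) in H.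
apply ln_le in H; [|apply pow_lt; lra].
rewrite !ln_mult, !ln_pow, plus_INR in H; simpl (INR 1) in H; try apply pow_lt; try lra.
- exact H.
- apply Rmult_lt_0_compat; lra.
Qed.

Lemma solution_fact_ln (A B K : nat) (L := ln (INR B + 1)) :
  (0 < A)%nat -> (fact A * fact B = fact (B + K))%nat -> INR K * L <= (INR A + 1) * ln (INR A) - INR A + 1.
Proof.
intros A_pos E; pose proof (solution_pow_le A B K E) as H; apply le_INR in H.
pose proof (pos_INR B).
rewrite pow_INR, plus_INR in H; simpl (INR 1) in H.
apply ln_le in H; [|apply pow_lt; lra].
rewrite ln_pow in H by lra.
pose proof (ln_fact_le A A_pos); unfold L; lra.
Qed.

Lemma solution_gap_ln (A B K : nat) (L := ln (INR B + 1)) :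
  (0 < B)%nat -> (2 <= K)%nat -> (A <= B)%nat -> (A <> 6 \/ K <> 3)%nat ->
  (fact A * fact B = fact (B + K))%nat -> 2 ^ K * ln 2 <= 16 / 7 * L.
Proof.
intros B_pos K2 AB ne E; pose proof (solution_gap_pow2 A B K B_pos K2 AB ne E) as H; apply le_INR in H.
pose proof (pos_INR B).
rewrite !pow_INR, plus_INR in H; simpl (INR 1) in H; simpl (INR 2) in H.
apply ln_le in H; [|apply pow_lt; lra].
rewrite !ln_pow, mult_INR, pow_INR in H by lra.
replace (INR 16) with 16 in H by (simpl; ring).
replace (INR 7) with 7 in H by (simpl; ring).
repeat change (INR 2) with 2 in H; change (1 + 1) with 2 in H; unfold L; lra.
Qed.

(** 2^K <= c L with c = 16 / (7 ln 2) <= 3.3, and 3.3^4 < 2^7 bounds log2 c by 7/4. *)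
Lemma solution_gap (A B K : nat) (L := ln (INR B + 1)) :
  (0 < B)%nat -> (2 <= K)%nat -> (A <= B)%nat -> (A <> 6 \/ K <> 3)%nat ->
  (fact A * fact B = fact (B + K))%nat -> INR K * ln 2 <= ln L + 7 / 4 * ln 2.
Proof.
intros B_pos K2 AB ne E; pose proof ln2_bounds as b2.
pose proof (solution_gap_ln A B K B_pos K2 AB ne E) as H; fold L in H.
assert (pw : 0 < 2 ^ K) by (apply pow_lt; lra).
assert (L_pos : 0 < L) by nra.
set (c := 16 / 7 / ln 2).
assert (c_pos : 0 < c) by (unfold c; apply Rdiv_lt_0_compat; lra).
assert (c_le : 4 * ln c <= 7 * ln 2).
{ assert (pow_le : c ^ 4 <= 2 ^ 7).
  { assert (c <= 3.3) by (unfold c; apply (proj2 (Rle_div_l _ _ (ln 2) ltac:(lra))); lra).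
    apply Rle_trans with (3.3 ^ 4); [apply pow_incr; lra|simpl; lra]. }
  apply ln_le in pow_le; [|apply pow_lt; lra].
  rewrite !ln_pow in pow_le by lra.
  replace (INR 4) with 4 in pow_le by (simpl; ring).
  replace (INR 7) with 7 in pow_le by (simpl; ring); exact pow_le. }
assert (le : 2 ^ K <= c * L).
{ unfold c; replace (16 / 7 / ln 2 * L) with (16 / 7 * L / ln 2) by (field; lra).
  apply (proj1 (Rle_div_r _ _ (ln 2) ltac:(lra))); lra. }
apply ln_le in le; [|assumption].
rewrite ln_pow, ln_mult in le by lra; lra.
Qed.

(** The crude bound K ln 2 = O(ln L) sharpens the dyadic inequality to A ln 2 <= L + O(ln L), which
    is fed into K L <= ln A!. Writing L = q^4 makes every error term a polynomial in q, because ln L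
    = 4 ln q <= 4 (q - 1). *)
Lemma gap_asymptotic (q K A : R) (L := q ^ 4) :
  4 <= q -> 1 <= A -> 0 <= K ->
  (A + 1) * ln 2 <= ln (A + 1) + L + K * ln 2 ->
  K * L <= (A + 1) * ln A - A + 1 ->
  K * ln 2 <= ln L + 7 / 4 * ln 2 ->
  K * ln 2 <= ln L - 1 - ln (ln 2) + 40 / q ^ 2.
Proof.
intros q4 A1 K0 dyad fact_le gap.
pose proof ln2_bounds as b2; pose proof lnln2_bounds as bb2.
assert (q2 : 0 < q ^ 2) by (apply pow_lt; lra).
assert (q2_ge : 4 * q <= q ^ 2) by nra.
assert (L_q : L = q ^ 2 * q ^ 2) by (unfold L; ring).
assert (L_ge : 16 * q ^ 2 <= L) by nra.
assert (ln_L : ln L = 4 * ln q).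
{ unfold L; rewrite ln_pow by lra; simpl; ring. }
assert (ln_q : ln q <= q - 1) by (apply ln_le_sub1; lra).
assert (ln_q2 : ln 2 <= ln q) by (apply ln_le; lra).
assert (ln4 : ln 4 = 2 * ln 2).
{ replace 4 with (2 ^ 2) by ring; rewrite ln_pow by lra; simpl; ring. }
(* The tangent to ln at 4 has slope 1/4 < ln 2, so ln (A+1) is absorbed on the left. *)
assert (A_le : A + 1 <= 4 * L).
{ pose proof (ln_le_tangent (A + 1) 4 ltac:(lra) ltac:(lra)); nra. }
assert (ln_A1 : ln (A + 1) <= 2 * ln 2 + ln L).
{ rewrite <- ln4, <- ln_mult by lra; apply ln_le; lra. }
assert (Y_le : A * ln 2 <= L + 8 * q) by lra.
assert (ln_A : ln A <= ln L - ln (ln 2) + 8 * q / L).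
{ assert (A2 : 0 < A * ln 2) by (apply Rmult_lt_0_compat; lra).
  pose proof (ln_le_tangent (A * ln 2) L A2 ltac:(lra)) as H.
  rewrite ln_mult in H by lra.
  assert (A * ln 2 / L <= 1 + 8 * q / L).
  { replace (1 + 8 * q / L) with ((L + 8 * q) / L) by (field; lra).
    apply Rmult_le_compat_r; [apply Rlt_le, Rinv_0_lt_compat|]; lra. }
  lra. }
assert (frac : 0 <= 8 * q / L <= 1 / 8).
{ split; [apply Rdiv_le_0_compat; lra|apply (proj2 (Rle_div_l _ _ L ltac:(lra))); lra]. }
(* W majorises ln A - 1, and the factorial bound is A (ln A - 1) + (ln A - 1) + 2. *)
set (W := ln L - ln (ln 2) - 1 + 8 * q / L) in *.
assert (W_bd : 0 <= W <= 4 * q) by (unfold W; lra).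
assert (main : K * L <= A * W + W + 2).
{ assert (A * (ln A - 1) <= A * W) by (apply Rmult_le_compat_l; unfold W; lra).
  assert (ln A - 1 <= W) by (unfold W; lra); lra. }
assert (main2 : K * ln 2 * L <= (L + 8 * q) * W + (W + 2)).
{ assert (A * ln 2 * W <= (L + 8 * q) * W) by (apply Rmult_le_compat_r; lra).
  assert ((W + 2) * ln 2 <= (W + 2) * 1) by (apply Rmult_le_compat_l; lra).
  apply (Rmult_le_compat_r (ln 2)) in main; lra. }
assert (LW : L * W = L * (ln L - 1 - ln (ln 2)) + 8 * q) by (unfold W; field; lra).
(* The excess 8 q + 8 q W + W + 2 is at most 40 q^2 = (40 / q^2) L, as W <= 4 q and 4 q <= q^2. *)
assert (main3 : K * ln 2 * L <= (ln L - 1 - ln (ln 2) + 40 / q ^ 2) * L).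
{ replace ((ln L - 1 - ln (ln 2) + 40 / q ^ 2) * L)
    with (L * (ln L - 1 - ln (ln 2)) + 40 * q ^ 2) by (rewrite L_q; field; lra).
  assert (q * W <= q * (4 * q)) by (apply Rmult_le_compat_l; lra).
  nra. }
apply Rmult_le_reg_r with L; lra.
Qed.

(** For A = 6 and C - B = 3 the equation is (B+1)(B+2)(B+3) = 720, which forces B = 7; so excluding
    one triple excludes the pair (A, K) = (6, 3). *)
Lemma nontrivial_solution_gap (A B C : nat) :
  nontrivial_solution A B C -> (A, B, C) <> (6, 7, 10)%nat ->
  exists K, C = (B + K)%nat /\ (0 < A)%nat /\ (0 < B)%nat /\ (2 <= K)%nat /\
    (A <= B)%nat /\ (A <> 6 \/ K <> 3)%nat /\ (fact A * fact B = fact (B + K))%nat.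
Proof.
intros [A_pos [B_pos [_ [AB [BC E]]]]] ne.
exists (C - B)%nat; replace (B + (C - B))%nat with C by lia.
repeat split; auto; [lia|].
destruct (Nat.eq_dec A 6) as [A6|]; [|auto].
destruct (Nat.eq_dec (C - B) 3) as [C3|]; [|auto].
exfalso; apply ne; subst A; replace C with (S (S (S B))) in * by lia.
change (fact 6) with 720%nat in E; rewrite !fact_simpl in E.
assert (B7 : B = 7%nat).
{ assert (E' : (720 = S (S (S B)) * (S (S B) * S B))%nat).
  { apply (Nat.mul_cancel_r _ _ (fact B) (fact_neq_0 B)); lia. }
  destruct (lt_eq_lt_dec B 7) as [[lt|]|gt]; [exfalso|assumption|exfalso].
  - assert (S (S (S B)) * (S (S B) * S B) <= 9 * (8 * 7))%nat
      by (repeat apply Nat.mul_le_mono; lia); lia.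
  - assert (11 * (10 * 9) <= S (S (S B)) * (S (S B) * S B))%nat
      by (repeat apply Nat.mul_le_mono; lia); lia. }
rewrite B7; reflexivity.
Qed.

Theorem theorem2 :
  (-0.9140 < - ((1 + ln (ln 2)) / ln 2) <= -0.9139) /\
  (forall u : R, u > - ((1 + ln (ln 2)) / ln 2) ->
     exists B0 : nat, forall A B C : nat,
       nontrivial_solution A B C -> (A, B, C) <> (6, 7, 10)%nat ->
       (B0 <= B)%nat ->
       INR C - INR B <= ln (ln (INR B + 1)) / ln 2 + u) /\
  (forall A B C : nat,
     nontrivial_solution A B C -> (A, B, C) <> (6, 7, 10)%nat ->
     INR C - INR B <= ln (ln (INR B + 1)) / ln 2 + 1.819).
Proof.
pose proof ln2_bounds as b2.
split; [exact threshold_bounds|split].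
- intros u u_gt.
  (* e is ln 2 times the distance from u to the threshold. *)
  set (e := u * ln 2 + 1 + ln (ln 2)).
  assert (e_pos : 0 < e).
  { unfold e; assert (0 < (u + (1 + ln (ln 2)) / ln 2) * ln 2)
      by (apply Rmult_lt_0_compat; lra).
    replace ((u + (1 + ln (ln 2)) / ln 2) * ln 2)
      with (u * ln 2 + 1 + ln (ln 2)) in H by (field; lra); exact H. }
  (* q >= Q ensures both q >= 4 and 40 / q^2 <= 40 / q <= e; B >= exp (Q^4) ensures q >= Q for q the
     fourth root of L. *)
  set (Q := 4 + 40 / e).
  assert (e40 : 0 < 40 / e) by (apply Rdiv_lt_0_compat; lra).
  destruct (INR_unbounded (exp (Q ^ 4))) as [B0 B0_gt].
  exists B0; intros A B C sol ne B0B.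
  destruct (nontrivial_solution_gap A B C sol ne)
    as [K [-> [A_pos [B_pos [K2 [AB [ne' E]]]]]]].
  apply le_INR in B0B; apply (le_INR 1) in A_pos; pose proof (pos_INR B).
  pose proof (solution_dyadic_ln A B K B_pos E) as dyad.
  pose proof (solution_fact_ln A B K (INR_le 1 A A_pos) E) as fact_le.
  pose proof (solution_gap A B K B_pos K2 AB ne' E) as gap.
  set (L := ln (INR B + 1)) in *.
  assert (L_ge : Q ^ 4 <= L).
  { rewrite <- (ln_exp (Q ^ 4)); apply ln_le; [apply exp_pos|lra]. }
  assert (Q4 : 0 < Q ^ 4) by (apply pow_lt; unfold Q; lra).
  set (q := sqrt (sqrt L)).
  assert (L_q : L = q ^ 4).
  { replace (q ^ 4) with ((q ^ 2) ^ 2) by ring; unfold q.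
    rewrite !pow2_sqrt; try apply sqrt_pos; lra. }
  assert (qQ : Q <= q).
  { assert (Q0 : 0 <= Q) by (unfold Q; lra).
    rewrite <- (sqrt_pow2 Q Q0); unfold q; apply sqrt_le_1_alt.
    rewrite <- (sqrt_pow2 (Q ^ 2)) by (apply pow_le; exact Q0).
    apply sqrt_le_1_alt; replace ((Q ^ 2) ^ 2) with (Q ^ 4) by ring; exact L_ge. }
  rewrite L_q in dyad, fact_le, gap |- *.
  pose proof (gap_asymptotic q (INR K) (INR A) ltac:(unfold Q in qQ; lra) A_pos (pos_INR K)
    dyad fact_le gap) as H1.
  assert (err : 40 / q ^ 2 <= e).
  { assert (40 <= e * q).
    { replace 40 with (e * (40 / e)) by (field; lra).
      apply Rmult_le_compat_l; unfold Q in qQ; lra. }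
    apply Rle_div_l; [apply pow_lt; unfold Q in qQ; lra|]. unfold Q in qQ; nra. }
  rewrite plus_INR; unfold e in err.
  apply Rmult_le_reg_r with (ln 2); [lra|].
  replace ((ln (q ^ 4) / ln 2 + u) * ln 2) with (ln (q ^ 4) + u * ln 2) by (field; lra).
  lra.
- intros A B C sol ne.
  destruct (nontrivial_solution_gap A B C sol ne)
    as [K [-> [A_pos [B_pos [K2 [AB [ne' E]]]]]]].
  (* Part (ii) follows already from the constant 7/4 < 1.819. *)
  pose proof (solution_gap A B K B_pos K2 AB ne' E) as gap.
  rewrite plus_INR; apply Rmult_le_reg_r with (ln 2); [lra|].
  replace ((ln (ln (INR B + 1)) / ln 2 + 1.819) * ln 2)
    with (ln (ln (INR B + 1)) + 1.819 * ln 2) by (field; lra).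
  lra.
Qed.
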